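(* Let $F$ be a field and let $\alpha,\beta\colon A\to B$ be graded homomorphisms of graded algebras over $F$. Denote by $C$ the linear span of all homogeneous elements $a\in A$ such that $\alpha(a)=\beta(a)$, and let $i\colon C\to A$ be the corresponding embedding. Then $i$ is an equalizer of $\alpha$ and $\beta$ both in $\mathbf{GrAlg}_F$ and in $\mathbf{GrAlg}^1_F$ (in the case of $\mathbf{GrAlg}^1_F$ it is required that $A$ and $B$ are unital and both $\alpha$ and $\beta$ are unital).
   Context: Algebras are associative over the field $F$, not necessarily unital or commutative. A grading on an algebra $A$ by a group $G$ is a decomposition $A=\bigoplus_{g\in G}A^{(g)}$ into a direct sum of subspaces with $A^{(g)}A^{(h)}\subseteq A^{(gh)}$ for all $g,h\in G$; the elements of $\bigcup_{g\in G}A^{(g)}$ are called homogeneous. A homomorphism of algebras $\psi\colon A\to B$ between algebras graded by groups $G$ and $H$ (possibly different) is graded if for every $g\in G$ there exists $h\in H$ with $\psi(A^{(g)})\subseteq B^{(h)}$. $\mathbf{GrAlg}_F$ is the category whose objects are all gradings by arbitrary groups on (not necessarily unital) associative $F$-algebras and whose morphisms are the graded homomorphisms. $\mathbf{GrAlg}^1_F$ is the category whose objects are all group gradings on unital associative $F$-algebras and whose morphisms are the unital graded homomorphisms. The subspace $C$ is a graded subalgebra of $A$ and carries the induced grading by the grading group $G$ of $A$, $C^{(g)}=C\cap A^{(g)}$. *)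

(* Defs.v *)
(* MathComp, with its classical layer for Prop-valued subspaces. *)
From HB Require Import structures.
From mathcomp Require Import all_boot all_order all_algebra.
From mathcomp Require Import boolp classical_sets.

Set Implicit Arguments.
Unset Strict Implicit.
Unset Printing Implicit Defensive.

Import GRing.Theory.
Local Open Scope classical_set_scope.
Local Open Scope ring_scope.

Record category := Category {
  obj : Type;
  mor : obj -> obj -> Type;
  idm : forall X, mor X X;
  compm : forall X Y Z, mor Y Z -> mor X Y -> mor X Z;
  compm_idl : forall X Y (f : mor X Y), compm (idm Y) f = f;
  compm_idr : forall X Y (f : mor X Y), compm f (idm X) = f;
  compmA : forall X Y Z T (h : mor Z T) (g : mor Y Z) (f : mor X Y),
    compm h (compm g f) = compm (compm h g) f }.

Arguments mor {c} X Y.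
Arguments idm {c} X.
Arguments compm {c X Y Z} g f.

Definition is_equalizer (K : category) (A B E : obj K)
    (f g : mor A B) (e : mor E A) : Prop :=
  compm f e = compm g e /\
  forall (X : obj K) (h : mor X A), compm f h = compm g h ->
    exists! u : mor X E, compm e u = h.

Record algebra (F : fieldType) := Algebra {
  alg_sort :> lmodType F;
  amul : alg_sort -> alg_sort -> alg_sort;
  amulA : associative amul;
  amulDl : left_distributive amul +%R;
  amulDr : right_distributive amul +%R;
  amulZl : forall (c : F) (x y : alg_sort), amul (c *: x) y = c *: amul x y;
  amulZr : forall (c : F) (x y : alg_sort), amul x (c *: y) = c *: amul x y }.

Definition is_subspace (F : fieldType) (V : lmodType F) (S : set V) : Prop :=
  S 0 /\ forall (c : F) (x y : V), S x -> S y -> S (c *: x + y).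

(* [gr_span] and [gr_indep] together say that A is the direct sum of the
   subspaces Agr g; only finitely many components enter each sum, the others
   being omitted from the duplicate-free list s. *)
Record is_grading (F : fieldType) (G : groupType) (A : algebra F)
    (Agr : G -> set A) : Prop := IsGrading {
  gr_subspace : forall g, is_subspace (Agr g);
  gr_span : forall x : A, exists (s : seq G) (v : G -> A),
    [/\ uniq s, forall g, Agr g (v g) & x = \sum_(g <- s) v g];
  gr_indep : forall (s : seq G) (v : G -> A), uniq s ->
    (forall g, Agr g (v g)) -> \sum_(g <- s) v g = 0 ->
    forall g, g \in s -> v g = 0;
  gr_mul : forall (g h : G) (x y : A),
    Agr g x -> Agr h y -> Agr (g * h)%g (amul x y) }.

Record gralg (F : fieldType) := GrAlgebra {
  gr_alg :> algebra F;
  gr_group : groupType;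
  gr_comp : gr_group -> set gr_alg;
  gr_axiom : is_grading gr_comp }.

Arguments gr_comp {F} A g : rename.

Definition homogeneous (F : fieldType) (A : gralg F) : set A :=
  [set a | exists g, gr_comp A g a].

Record is_graded_hom (F : fieldType) (A B : gralg F) (f : A -> B) : Prop :=
  IsGradedHom {
  hom_linear : forall (c : F) (x y : A), f (c *: x + y) = c *: f x + f y;
  hom_mul : forall x y : A, f (amul x y) = amul (f x) (f y);
  hom_graded : forall g : gr_group A, exists h : gr_group B,
    forall x, gr_comp A g x -> gr_comp B h (f x) }.

Record grhom (F : fieldType) (A B : gralg F) := GrHom {
  grhom_fun :> A -> B;
  grhom_axiom : is_graded_hom grhom_fun }.

Section GrAlgCategory.
Variable F : fieldType.
Implicit Types A B C D : gralg F.

Lemma grhom_eq A B (f g : grhom A B) : f =1 g -> f = g.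
Proof.
case: f g => [f Pf] [g Pg] /= /funext fg.
by case: g / fg Pg => Pg; rewrite (Prop_irrelevance Pf Pg).
Qed.

Lemma grid_axiom A : is_graded_hom (@id A).
Proof. by split=> // g; exists g. Qed.

Definition grid A : grhom A A := GrHom (grid_axiom A).

Lemma grcomp_axiom A B C (f : grhom B C) (g : grhom A B) :
  is_graded_hom (f \o g).
Proof.
case: (grhom_axiom f) (grhom_axiom g) => [fL fM fG] [gL gM gG]; split=> /=.
- by move=> c x y; rewrite gL fL.
- by move=> x y; rewrite gM fM.
- move=> k; have [l gl] := gG k; have [m fm] := fG l.
  by exists m => x /gl/fm.
Qed.

Definition grcomp A B C (f : grhom B C) (g : grhom A B) : grhom A C :=
  GrHom (grcomp_axiom f g).

Lemma grcomp_idl A B (f : grhom A B) : grcomp (grid B) f = f.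
Proof. exact: grhom_eq. Qed.

Lemma grcomp_idr A B (f : grhom A B) : grcomp f (grid A) = f.
Proof. exact: grhom_eq. Qed.

Lemma grcompA A B C D (h : grhom C D) (g : grhom B C) (f : grhom A B) :
  grcomp h (grcomp g f) = grcomp (grcomp h g) f.
Proof. exact: grhom_eq. Qed.

Definition GrAlg : category := Category grcomp_idl grcomp_idr grcompA.

End GrAlgCategory.

(* The zero algebra is allowed: 1 = 0 is not excluded. *)
Record ugralg (F : fieldType) := UGrAlgebra {
  u_gralg :> gralg F;
  aone : u_gralg;
  amul1l : left_id aone (@amul F u_gralg);
  amul1r : right_id aone (@amul F u_gralg) }.

Arguments aone {F A} : rename.

Record ugrhom (F : fieldType) (A B : ugralg F) := UGrHom {
  ugrhom_grhom :> grhom A B;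
  ugrhom_one : ugrhom_grhom aone = aone }.

Section GrAlg1Category.
Variable F : fieldType.
Implicit Types A B C D : ugralg F.

Lemma ugrhom_eq A B (f g : ugrhom A B) : f =1 g -> f = g.
Proof.
case: f g => [f f1] [g g1] /= /grhom_eq fg.
by case: g / fg g1 => g1; rewrite (Prop_irrelevance f1 g1).
Qed.

Definition ugrid A : ugrhom A A := @UGrHom F A A (grid A) erefl.

Lemma ugrcomp_one A B C (f : ugrhom B C) (g : ugrhom A B) :
  grcomp f g aone = aone.
Proof. by rewrite /= !ugrhom_one. Qed.

Definition ugrcomp A B C (f : ugrhom B C) (g : ugrhom A B) : ugrhom A C :=
  UGrHom (ugrcomp_one f g).

Lemma ugrcomp_idl A B (f : ugrhom A B) : ugrcomp (ugrid B) f = f.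
Proof. exact: ugrhom_eq. Qed.

Lemma ugrcomp_idr A B (f : ugrhom A B) : ugrcomp f (ugrid A) = f.
Proof. exact: ugrhom_eq. Qed.

Lemma ugrcompA A B C D (h : ugrhom C D) (g : ugrhom B C) (f : ugrhom A B) :
  ugrcomp h (ugrcomp g f) = ugrcomp (ugrcomp h g) f.
Proof. exact: ugrhom_eq. Qed.

Definition GrAlg1 : category := Category ugrcomp_idl ugrcomp_idr ugrcompA.

End GrAlg1Category.

Definition lin_span (F : fieldType) (V : lmodType F) (S : set V) : set V :=
  [set x | exists (n : nat) (c : 'I_n -> F) (v : 'I_n -> V),
     (forall i, S (v i)) /\ x = \sum_(i < n) c i *: v i].

Section LinSpan.
Variables (F : fieldType) (V : lmodType F) (S : set V).

Lemma lin_span_gen x : S x -> lin_span S x.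
Proof.
move=> Sx; exists 1%N, (fun=> 1), (fun=> x); split=> //.
by rewrite big_ord1 scale1r.
Qed.

Lemma lin_span_ind (T : set V) :
  is_subspace T -> S `<=` T -> lin_span S `<=` T.
Proof.
move=> [T0 TD] ST _ [n [c [v [Sv ->]]]]; elim/big_rec: _ => // i x _ Tx.
by apply: TD => //; exact: ST.
Qed.

Lemma lin_span_subspace : is_subspace (lin_span S).
Proof.
split.
  by exists 0%N, (fun=> 0), (fun=> 0); rewrite big_ord0; split=> // -[].
move=> a _ _ [n [c [v [Sv ->]]]] [m [d [w [Sw ->]]]].
exists (n + m)%N.
exists (fun i => match split i with inl j => a * c j | inr k => d k end).
exists (fun i => match split i with inl j => v j | inr k => w k end).
split; first by move=> i; case: split.
rewrite big_split_ord scaler_sumr /=; congr (_ + _); apply: eq_bigr => i _.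
  by rewrite (unsplitK (inl _ i)) scalerA.
by rewrite (unsplitK (inr _ i)).
Qed.

Definition span_pred : {pred V} := [pred x | `[< lin_span S x >]].

Lemma span_submod_closed : submod_closed span_pred.
Proof.
have [S0 SD] := lin_span_subspace; split; first exact/asboolP.
by move=> a x y /asboolP Sx /asboolP Sy; exact/asboolP/SD.
Qed.

HB.instance Definition _ :=
  GRing.isSubmodClosed.Build F V span_pred span_submod_closed.

Definition span_type : Type := {x : V | x \in span_pred}.
HB.instance Definition _ := SubType.on span_type.
HB.instance Definition _ := [Choice of span_type by <:].
HB.instance Definition _ := [SubChoice_isSubLmodule of span_type by <:].

Lemma span_valP (x : span_type) : lin_span S (val x).
Proof. exact/asboolP/(valP x). Qed.

Definition span_in x (Sx : lin_span S x) : span_type := exist _ x (asboolT Sx).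

End LinSpan.

Section Equalizer.
Variables (F : fieldType) (A B : gralg F) (alpha beta : grhom A B).

Definition agree_homogeneous : set A :=
  [set a | homogeneous a /\ alpha a = beta a].

Let span := lin_span agree_homogeneous.

Lemma amul0l (D : algebra F) (x : D) : amul 0 x = 0.
Proof. by rewrite -(scale0r x) amulZl !scale0r. Qed.

Lemma amul0r (D : algebra F) (x : D) : amul x 0 = 0.
Proof. by rewrite -(scale0r x) amulZr !scale0r. Qed.

Lemma equ_mul_closed x y : span x -> span y -> span (amul x y).
Proof.
have [S0 SD] := lin_span_subspace agree_homogeneous.
move=> Sx Sy; suff sub : span `<=` [set z | span (amul z y)] by exact: sub.
apply: lin_span_ind => [|{Sx}x [[g gx] fx]] /=.
  split=> [|c u v Tu Tv] /=; first by rewrite amul0l.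
  by rewrite amulDl amulZl; exact: SD.
suff sub : span `<=` [set z | span (amul x z)] by exact: sub.
apply: lin_span_ind => [|{Sy}y [[h hy] fy]] /=.
  split=> [|c u v Tu Tv] /=; first by rewrite amul0r.
  by rewrite amulDr amulZr; exact: SD.
apply: lin_span_gen; split.
  by exists (g * h)%g; exact: (gr_mul (gr_axiom A)).
by rewrite (hom_mul (grhom_axiom alpha)) (hom_mul (grhom_axiom beta)) fx fy.
Qed.

Definition equ_sort : lmodType F := span_type agree_homogeneous.

Definition equ_mul (x y : equ_sort) : equ_sort :=
  span_in (equ_mul_closed (span_valP x) (span_valP y)).

Lemma equ_mulA : associative equ_mul.
Proof. by move=> x y z; apply/val_inj; rewrite /= amulA. Qed.

Lemma equ_mulDl : left_distributive equ_mul +%R.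
Proof. by move=> x y z; apply/val_inj; rewrite /= amulDl. Qed.

Lemma equ_mulDr : right_distributive equ_mul +%R.
Proof. by move=> x y z; apply/val_inj; rewrite /= amulDr. Qed.

Lemma equ_mulZl c (x y : equ_sort) : equ_mul (c *: x) y = c *: equ_mul x y.
Proof. by apply/val_inj; rewrite /= amulZl. Qed.

Lemma equ_mulZr c (x y : equ_sort) : equ_mul x (c *: y) = c *: equ_mul x y.
Proof. by apply/val_inj; rewrite /= amulZr. Qed.

Definition equ_alg : algebra F :=
  Algebra equ_mulA equ_mulDl equ_mulDr equ_mulZl equ_mulZr.

Definition equ_comp (g : gr_group A) : set equ_alg :=
  [set x | gr_comp A g (val (x : equ_sort))].

Lemma equ_decomp x : span x -> exists (s : seq (gr_group A)) (v : gr_group A -> A),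
  [/\ uniq s, forall g, gr_comp A g (v g) /\ span (v g) & x = \sum_(g <- s) v g].
Proof.
have Asub := gr_subspace (gr_axiom A).
have [S0 SD] := lin_span_subspace agree_homogeneous.
have extend (s t : seq (gr_group A)) (v : gr_group A -> A) :
    uniq s -> uniq t -> {subset s <= t} ->
    \sum_(g <- t) (if g \in s then v g else 0) = \sum_(g <- s) v g.
  move=> us ut st; rewrite -big_mkcond /= -big_filter; apply: perm_big.
  apply: uniq_perm; rewrite ?filter_uniq // => g; rewrite mem_filter.
  by apply: andb_idr => /st.
move=> Sx; pattern x; move: x Sx; apply: lin_span_ind.
  split.
    exists [::], (fun=> 0); split=> //; last by rewrite big_nil.
    by move=> g; split=> //; case: (Asub g).
  move=> c _ _ [s [v [us vP ->]]] [t [w [ut wP ->]]].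
  pose r := undup (s ++ t).
  exists r, (fun g => c *: (if g \in s then v g else 0) +
                      (if g \in t then w g else 0)); split.
  - exact: undup_uniq.
  - move=> g; have [A0 AD] := Asub g; have [Av Sv] := vP g; have [Aw Sw] := wP g.
    by split; [apply: AD | apply: SD]; case: ifP.
  rewrite big_split -scaler_sumr !extend ?undup_uniq // => g;
    by rewrite mem_undup mem_cat => ->; rewrite ?orbT.
move=> x [[g gx] fx]; exists [:: g], (fun h => if h == g then x else 0); split=> //.
  move=> h; case: eqP => [->|_]; last by split=> //; case: (Asub h).
  by split=> //; apply: lin_span_gen; split=> //; exists g.
by rewrite big_seq1 eqxx.
Qed.

Lemma equ_val_sum (s : seq (gr_group A)) (v : gr_group A -> equ_sort) :
  val (\sum_(g <- s) v g) = \sum_(g <- s) val (v g).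
Proof. by rewrite raddf_sum. Qed.

Lemma equ_grading : is_grading equ_comp.
Proof.
split.
- move=> g; have [A0 AD] := gr_subspace (gr_axiom A) g.
  by split=> [|c x y]; [exact: A0 | exact: AD].
- move=> x; have [s [v [us vP xE]]] := equ_decomp (span_valP x).
  exists s, (fun g => span_in (vP g).2); split=> //.
    by move=> g; exact: (vP g).1.
  by apply/val_inj; rewrite equ_val_sum xE.
- move=> s v us vP v0 g gs; apply/val_inj.
  apply: (gr_indep (gr_axiom A) us (v := fun h => val (v h))) gs => //.
  by rewrite -equ_val_sum v0.
- by move=> g h x y; exact: (gr_mul (gr_axiom A)).
Qed.

Definition equ : gralg F := GrAlgebra equ_grading.

Definition equ_fun : equ -> A := fun x => val (x : equ_sort).

Lemma equ_fun_axiom : is_graded_hom equ_fun.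
Proof. by split=> // g; exists g. Qed.

Definition equ_embed : grhom equ A := GrHom equ_fun_axiom.

End Equalizer.

Section UnitalEqualizer.
Variables (F : fieldType) (A B : ugralg F) (alpha beta : ugrhom A B).

(* The unit of a group-graded algebra is homogeneous of degree 1. *)
Lemma homogeneous_one : homogeneous (aone : A).
Proof.
have Asub := gr_subspace (gr_axiom A).
have [s [v [us vP oneE]]] := gr_span (gr_axiom A) aone.
pose r := undup (1%g :: s); pose w g := if g \in s then v g else 0.
have wP g : gr_comp A g (w g) by rewrite /w; case: ifP => // _; case: (Asub g).
have ur : uniq r by exact: undup_uniq.
have r1 : 1%g \in r by rewrite mem_undup mem_head.
have oneEr : aone = \sum_(g <- r) w g.
  rewrite oneE /w -big_mkcond /= -[RHS]big_filter; apply: perm_big.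
  apply: uniq_perm; rewrite ?filter_uniq // => g.
  by rewrite mem_filter mem_undup inE; case: (g \in s); rewrite ?orbT ?andbF.
have mul_sumr x : amul x (\sum_(g <- r) w g) = \sum_(g <- r) amul x (w g).
  by elim/big_rec2: _ => [|g y z _ <-]; rewrite ?amul0r ?amulDr.
have mul_suml x : amul (\sum_(g <- r) w g) x = \sum_(g <- r) amul (w g) x.
  by elim/big_rec2: _ => [|g y z _ <-]; rewrite ?amul0l ?amulDl.
suff xw h x : gr_comp A h x -> amul x (w 1%g) = x.
  exists 1%g; suff -> : aone = w 1%g by [].
  rewrite -[RHS]amul1l [in RHS]oneEr mul_suml oneEr.
  by apply: eq_bigr => g _; rewrite (xw g).
move=> hx; pose u k := amul x (w (h^-1 * k)%g) - (if k == h then x else 0).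
suff /eqP : u h = 0 by rewrite /u mulVg eqxx subr_eq0 => /eqP.
apply: (gr_indep (gr_axiom A) (s := [seq (h * g)%g | g <- r]) (v := u)).
- by rewrite map_inj_uniq //; exact: mulgI.
- move=> k; have [A0 AD] := Asub k; rewrite /u addrC -scaleN1r; apply: AD.
    by case: eqP => [->|].
  by have := gr_mul (gr_axiom A) hx (wP (h^-1 * k)%g); rewrite mulVKg.
- rewrite big_map sumrB; apply/eqP; rewrite subr_eq0; apply/eqP.
  transitivity (amul x aone).
    by rewrite oneEr mul_sumr; apply: eq_bigr => g _; rewrite mulKg.
  rewrite amul1r -big_mkcond /= (eq_bigl (pred1 1%g)).
    by rewrite -big_filter filter_pred1_uniq // big_seq1.
  by move=> g; rewrite /= -{2}[h]mulg1 (inj_eq (mulgI h)).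
- by rewrite -{1}[h]mulg1; exact: map_f.
Qed.

Lemma equ_one_in : lin_span (agree_homogeneous alpha beta) aone.
Proof.
by apply: lin_span_gen; split; [exact: homogeneous_one | rewrite !ugrhom_one].
Qed.

Definition uequ_one : equ alpha beta := span_in equ_one_in.

Lemma uequ_mul1l : left_id uequ_one (@amul F (equ alpha beta)).
Proof. by move=> x; apply/val_inj; rewrite /= amul1l. Qed.

Lemma uequ_mul1r : right_id uequ_one (@amul F (equ alpha beta)).
Proof. by move=> x; apply/val_inj; rewrite /= amul1r. Qed.

Definition uequ : ugralg F := UGrAlgebra uequ_mul1l uequ_mul1r.

Definition uequ_embed : ugrhom uequ A :=
  @UGrHom F uequ A (equ_embed alpha beta) erefl.

End UnitalEqualizer.

(* Main.v *)
Require Import Defs.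
From mathcomp Require Import all_boot all_order all_algebra.
From mathcomp Require Import boolp classical_sets.

(** The elements on which [alpha] and [beta] agree form a subspace, so the two
    maps agree on the whole span [C] ([equ_embedP]); the point is universality.

    A graded homomorphism sends homogeneous elements to homogeneous elements.
    So if [h : X -> A] satisfies [alpha \o h = beta \o h], the image under [h]
    of a homogeneous element of [X] is one of the generators of the span [C];
    since [X] is spanned by its homogeneous elements, [h] lands in [C]
    ([equalizing_in_span]). Its corestriction to [C] is again graded, because
    [C] carries the grading induced from [A] ([corestrict_axiom]). It is the
    only possible factorization, the embedding of [C] being injective.

    Grading of the morphisms is what makes this work: the set-theoretic
    equalizer of [alpha] and [beta] may be larger than [C], but no graded
    equalizing morphism reaches the difference.

    In the unital case [C] contains the unit of [A], which is homogeneous and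
    preserved by [alpha] and [beta]; so the same corestriction is unital as
    soon as [h] is. *)

Import GRing.Theory.
Local Open Scope classical_set_scope.
Local Open Scope ring_scope.

Lemma grhom0 (F : fieldType) (A B : gralg F) (f : grhom A B) : f 0 = 0.
Proof.
have := hom_linear (grhom_axiom f) (-1) 0 0.
by rewrite scaler0 addr0 scaleN1r addNr.
Qed.

Section Factorization.
Context {F : fieldType} {A B : gralg F}.
Implicit Types (X : gralg F) (alpha beta : grhom A B).

(** The span is a subspace, so it is enough to treat the homogeneous components
    of [x], whose images are generators of the span. *)
Lemma equalizing_in_span alpha beta X (h : grhom X A) :
  (forall x, alpha (h x) = beta (h x)) ->
  forall x, lin_span (agree_homogeneous alpha beta) (h x).
Proof.
move=> ab x; have [hL _ hG] := grhom_axiom h.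
have [S0 SD] := lin_span_subspace (agree_homogeneous alpha beta).
have [s [v [_ vP ->]]] := gr_span (gr_axiom X) x.
elim: s => [|g s IHs]; first by rewrite big_nil grhom0.
rewrite big_cons -[v g]scale1r hL; apply: SD => //.
apply: lin_span_gen; split; last exact: ab.
by have [k hk] := hG g; exists k; apply: hk.
Qed.

Section Corestriction.
Context {alpha beta : grhom A B} {X : gralg F} {h : grhom X A}.
Context (ab : forall x, alpha (h x) = beta (h x)).

Let corestrict_fun (x : X) : equ alpha beta :=
  span_in (equalizing_in_span alpha beta X h ab x).

Lemma corestrict_axiom : is_graded_hom corestrict_fun.
Proof.
have [hL hM hG] := grhom_axiom h; split.
- by move=> c x y; apply/val_inj; rewrite /= hL.
- by move=> x y; apply/val_inj; rewrite /= hM.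
- by move=> g; have [k hk] := hG g; exists k => x; exact: hk.
Qed.

Definition corestrict : grhom X (equ alpha beta) := GrHom corestrict_axiom.

End Corestriction.

Lemma equ_embed_inj alpha beta : injective (equ_embed alpha beta).
Proof. exact: val_inj. Qed.

Lemma equ_embedP alpha beta (x : equ alpha beta) :
  alpha (equ_embed alpha beta x) = beta (equ_embed alpha beta x).
Proof.
have [aL _ _] := grhom_axiom alpha; have [bL _ _] := grhom_axiom beta.
have agreeS : is_subspace [set a | alpha a = beta a].
  by split=> [|c a b /= ea eb]; rewrite /= ?grhom0 // aL bL ea eb.
by apply: (lin_span_ind agreeS _ (span_valP x)) => a [].
Qed.

End Factorization.

Theorem proposition5p3 (F : fieldType) :
  (forall (A B : obj (GrAlg F)) (alpha beta : mor A B),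
     @is_equalizer (GrAlg F) A B (equ alpha beta) alpha beta
       (equ_embed alpha beta)) /\
  (forall (A B : obj (GrAlg1 F)) (alpha beta : mor A B),
     @is_equalizer (GrAlg1 F) A B (uequ alpha beta) alpha beta
       (uequ_embed alpha beta)).
Proof.
split=> A B alpha beta; split.
- by apply: grhom_eq => x; exact: equ_embedP.
- move=> X h abh.
  have ab x : alpha (h x) = beta (h x).
    exact: (congr1 (fun f : grhom X B => f x) abh).
  exists (corestrict ab); split; first exact: grhom_eq.
  move=> u uh; apply: grhom_eq => x; apply: equ_embed_inj.
  exact: (esym (congr1 (fun f : grhom X A => f x) uh)).
- by apply: ugrhom_eq => x; exact: equ_embedP.
- move=> X h abh.
  have ab x : alpha (h x) = beta (h x).
    exact: (congr1 (fun f : ugrhom X B => f x) abh).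
  have one1 : corestrict ab (aone : X) = aone :> uequ alpha beta.
    by apply: equ_embed_inj; exact: (ugrhom_one h).
  exists (@UGrHom F X (uequ alpha beta) (corestrict ab) one1).
  split; first exact: ugrhom_eq.
  move=> u uh; apply: ugrhom_eq => x; apply: equ_embed_inj.
  exact: (esym (congr1 (fun f : ugrhom X A => f x) uh)).
Qed.
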